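(* Let $G$ be a group. If $B=\bigoplus_{t\in G}B_t$ is a strongly-graded algebra, then $B$ is strongly-graded-equivalent to $(B\#G)\rtimes_{\beta^B}G$.
   Context: Algebras are associative, not necessarily unital, over a fixed commutative associative unital ring $k$; $G$ is an arbitrary group. Products of subsets such as $UV$ denote the $k$-span of all products $uv$. An algebra $A$ is idempotent if $A^2=A$. A $G$-graded algebra $B=\bigoplus_tB_t$ ($B_sB_t\subseteq B_{st}$) is strongly-graded if $B_rB_t=B_{rt}$ for all $r,t\in G$. A bimodule ${}_RM_S$ is unital if $RM=M=MS$. Smash product: $B\#G:=\bigoplus_{r,s\in G}B_{r^{-1}s}e_{r,s}$, a subalgebra of the algebra of $G\times G$-matrices over $B$ with finitely many nonzero entries ($b\,e_{r,s}$ has $b$ at position $(r,s)$ and $0$ elsewhere). The action $\beta^B$ of $G$ on $B\#G$ is $\beta^B_t(b\,e_{r,s})=b\,e_{tr,ts}$. The skew group algebra is $(B\#G)\rtimes_{\beta^B}G=\bigoplus_{t}(B\#G)\delta_t$ with $(c\delta_s)(d\delta_t)=c\,\beta^B_s(d)\delta_{st}$, graded with $(B\#G)\delta_t$ in degree $t$. For a graded algebra $A$ put $D^A_t:=A_tA_{t^{-1}}$, a two-sided ideal of $A_1$. A Morita context $(A,B,X,Y,\tau_A,\tau_B)$ consists of algebras $A,B$, an $(A,B)$-bimodule $X$, a $(B,A)$-bimodule $Y$, an $A$-bimodule map $\tau_A:X\otimes_BY\to A$ and a $B$-bimodule map $\tau_B:Y\otimes_AX\to B$ with $\tau_A(x\otimes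 y)x'=x\tau_B(y\otimes x')$ and $\tau_B(y\otimes x)y'=y\tau_A(x\otimes y')$. It is a graded Morita context between idempotent $G$-graded algebras $A,B$ if $X=\bigoplus_tX_t$, $Y=\bigoplus_tY_t$ are $G$-graded bimodules, and $\tau_A(X_r\otimes_B Y_s)\subseteq A_{rs}$, $\tau_B(Y_r\otimes_A X_s)\subseteq B_{rs}$ for all $r,s\in G$. Suppose all $D^A_t,D^B_t$ are idempotent. A graded Morita context is strong if each $X_t$ is a unital $(D^A_t,D^B_{t^{-1}})$-bimodule and each $Y_t$ is a unital $(D^B_t,D^A_{t^{-1}})$-bimodule. The idempotent graded algebras $A$ and $B$ are strongly-graded-equivalent if there is a strong graded Morita context with $\tau_A,\tau_B$ surjective such that, for all $t\in G$, the $k$-span of $\{\tau_A(x\otimes y):x\in X_t,y\in Y_{t^{-1}}\}$ is $D^A_t$ and the $k$-span of $\{\tau_B(y\otimes x):y\in Y_t,x\in X_{t^{-1}}\}$ is $D^B_t$. *)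

(* Defs.v *)
From HB Require Import structures.
From mathcomp Require Import all_boot all_algebra all_classical.

Set Implicit Arguments.
Unset Strict Implicit.
Unset Printing Implicit Defensive.

Import GRing.Theory.

Local Open Scope classical_set_scope.
Local Open Scope ring_scope.

Section Submodules.
Variables (k : comPzRingType) (M : lmodType k).

Definition submodule (U : set M) : Prop :=
  U 0 /\ forall (a : k) u v, U u -> U v -> U (a *: u + v).

Definition span (S : set M) : set M := smallest submodule S.

Lemma submoduleD U u v : submodule U -> U u -> U v -> U (u + v).
Proof. by move=> [_ h] uU vU; rewrite -[u]scale1r; exact: h. Qed.

Lemma submoduleZ U a u : submodule U -> U u -> U (a *: u).
Proof. by move=> [U0 h] uU; rewrite -[_ *: _]addr0; exact: h. Qed.

Lemma submodule_sum U (I : Type) (r : seq I) (P : pred I) (f : I -> M) :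
  submodule U -> (forall i, P i -> U (f i)) -> U (\sum_(i <- r | P i) f i).
Proof.
move=> hU hf; elim/big_ind : _ => //; first by case: hU.
by move=> u v; exact: submoduleD.
Qed.

Lemma span_submodule S : submodule (span S).
Proof.
split=> [U [[U0 _] _] //|a u v uS vS U [hU SU]].
by case: (hU) => _; apply; [exact: uS|exact: vS].
Qed.

Lemma sub_span S : S `<=` span S.
Proof. exact: sub_gen_smallest. Qed.

Lemma span_sub S U : submodule U -> S `<=` U -> span S `<=` U.
Proof. exact: smallest_sub. Qed.

End Submodules.

Section LinearFunctions.
Variables (k : comPzRingType) (U V : lmodType k) (f : U -> V).
Hypothesis f_linear : linear f.

Lemma lin0 : f 0 = 0.
Proof. by have := f_linear (-1) 0 0; rewrite scaler0 addr0 scaleN1r addNr. Qed.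

Lemma linD u v : f (u + v) = f u + f v.
Proof. by have := f_linear 1 u v; rewrite !scale1r. Qed.

Lemma linZ a u : f (a *: u) = a *: f u.
Proof. by have := f_linear a u 0; rewrite lin0 !addr0. Qed.

Lemma lin_sum (I : Type) (r : seq I) (P : pred I) (F : I -> U) :
  f (\sum_(i <- r | P i) F i) = \sum_(i <- r | P i) f (F i).
Proof. by elim/big_rec2 : _ => [|i u v _ <-]; rewrite (lin0, linD). Qed.

Lemma submodule_preim (W : set V) : submodule W -> submodule (f @^-1` W).
Proof.
move=> [W0 hW]; split=> [|a u v] /=; first by rewrite lin0.
by rewrite f_linear; exact: hW.
Qed.

End LinearFunctions.

(* Finitely supported families I -> M, that is, the direct sum of copies of M
   indexed by I. *)
Section FiniteSupport.
Variables (k : comPzRingType) (I : choiceType) (M : lmodType k).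

Definition fin_supp : {pred I -> M} :=
  fun f => `[< finite_set [set i | f i != 0] >].

Lemma fin_suppP (f : I -> M) :
  (f \in fin_supp) <-> exists2 L : seq I, uniq L & forall i, i \notin L -> f i = 0.
Proof.
split=> [/asboolP /finite_seqP [s hs]|[L uL hL]].
  exists (undup s) => [|i]; first exact: undup_uniq.
  rewrite mem_undup => si; apply/eqP; apply: contraNT si => fi.
  by have : [set` s] i by rewrite -hs.
apply/asboolP; apply: (@sub_finite_set _ _ [set` L]); last exact: finite_seq.
by move=> i /= fi; apply: contraNT fi => /hL ->.
Qed.

Lemma fin_supp_submod : submod_closed fin_supp.
Proof.
split; first by apply/fin_suppP; exists [::].
move=> a f g /fin_suppP [L _ hL] /fin_suppP [L' _ hL'].
apply/fin_suppP; exists (undup (L ++ L')); first exact: undup_uniq.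
move=> i; rewrite mem_undup mem_cat negb_or => /andP [/hL fi /hL' gi].
have -> : (a *: f + g) i = a *: f i + g i by [].
by rewrite fi gi scaler0 addr0.
Qed.

HB.instance Definition _ := GRing.isSubmodClosed.Build k (I -> M) fin_supp
  fin_supp_submod.

Record fsupp := Fsupp { fsupp_fun :> I -> M; fsupp_fin : fsupp_fun \in fin_supp }.

HB.instance Definition _ := [isSub for fsupp_fun].
HB.instance Definition _ := [Choice of fsupp by <:].
HB.instance Definition _ := [SubChoice_isSubLmodule of fsupp by <:].

End FiniteSupport.

Section FiniteSupportTheory.
Variables (k : comPzRingType) (I : choiceType).

Lemma fsumE (M : lmodType k) (L : seq I) (f : I -> M) :
  uniq L -> (forall i, i \notin L -> f i = 0) ->
  \sum_(i \in [set: I]) f i = \sum_(i <- L) f i.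
Proof.
move=> uL hL; rewrite (fsbigE L) //; last by move=> i _; exact: hL.
by apply: eq_bigl => i; rewrite in_setT.
Qed.

Variable M : lmodType k.
Implicit Types f g : fsupp I M.

Lemma fsuppP f g : (forall i, f i = g i) <-> f = g.
Proof. by split=> [h|-> //]; apply: val_inj; apply/funext. Qed.

Lemma fsuppL f : exists2 L : seq I, uniq L & forall i, i \notin L -> f i = 0.
Proof. by apply/fin_suppP/(fsupp_fin f). Qed.

Lemma fsuppDE f g i : (f + g) i = f i + g i.
Proof. by []. Qed.

Lemma fsuppZE (a : k) f i : (a *: f) i = a *: f i.
Proof. by []. Qed.

Lemma fsupp_sumE (J : Type) (r : seq J) (P : pred J) (f : J -> fsupp I M) i :
  (\sum_(j <- r | P j) f j) i = \sum_(j <- r | P j) f j i.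
Proof. by elim/big_rec2 : _ => // j u v _ <-. Qed.

Lemma fdelta_subproof i (m : M) :
  (fun j => if j == i then m else 0) \in @fin_supp k I M.
Proof.
apply/fin_suppP; exists [:: i] => // j; rewrite inE => /negbTE ->//.
Qed.

Definition fdelta i m : fsupp I M := Fsupp (fdelta_subproof i m).

Lemma fsupp_decomp f (L : seq I) : uniq L -> (forall i, i \notin L -> f i = 0) ->
  f = \sum_(i <- L) fdelta i (f i).
Proof.
move=> uL hL; apply/fsuppP => j; rewrite fsupp_sumE /=.
have [jL|jL] := boolP (j \in L).
  rewrite (bigD1_seq j) //= eqxx big1 ?addr0 // => i /negbTE.
  by rewrite eq_sym => ->.
rewrite hL // big1_seq // => i /andP [_ iL]; case: eqP => // ji.
by rewrite -ji in iL; rewrite iL in jL.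
Qed.

End FiniteSupportTheory.

Definition direct_sum (k : comPzRingType) (I : choiceType) (M : lmodType k)
    (U : I -> set M) : Prop :=
  (forall i, submodule (U i)) /\
  forall m, exists! f : fsupp I M,
    (forall i, U i (f i)) /\ m = \sum_(i \in [set: I]) f i.

(* Associative k-algebras, not necessarily unital. *)
HB.mixin Record LModule_isNUAlgebra (k : comPzRingType) A of GRing.Lmodule k A := {
  nmul : A -> A -> A;
  nmulA : associative nmul;
  nmul_linearl : forall b, linear (nmul^~ b);
  nmul_linearr : forall a, linear (nmul a)
}.

#[short(type="nuAlgType")]
HB.structure Definition NUAlgebra (k : comPzRingType) :=
  {A of LModule_isNUAlgebra k A & GRing.Lmodule k A}.

Notation "a ** b" := (nmul a b) (at level 40, left associativity) : ring_scope.

Section NUAlgebraTheory.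
Variables (k : comPzRingType) (A : nuAlgType k).

Lemma nmul0l (b : A) : 0 ** b = 0.
Proof. exact: (lin0 (nmul_linearl b)). Qed.

Lemma nmul0r (a : A) : a ** 0 = 0.
Proof. exact: (lin0 (nmul_linearr a)). Qed.

End NUAlgebraTheory.

(* The k-span of all f u v, with u in U and v in V. *)
Definition span2 (k : comPzRingType) (X Y : Type) (Z : lmodType k)
    (f : X -> Y -> Z) (U : set X) (V : set Y) : set Z :=
  span [set f u v | u in U & v in V].

Definition idempotent_alg (k : comPzRingType) (A : nuAlgType k) : Prop :=
  span2 (@nmul k A) setT setT = setT.

(* G x G matrices with finitely many nonzero entries. *)
Definition fmat (k : comPzRingType) (G : groupType) (B : nuAlgType k) : Type :=
  fsupp (G * G)%type B.

Identity Coercion fsupp_of_fmat : fmat >-> fsupp.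

Section FiniteMatrices.
Variables (k : comPzRingType) (G : groupType) (B : nuAlgType k).
Implicit Types a b c : fmat G B.

HB.instance Definition _ := GRing.Lmodule.on (fmat G B).

(* A finite set of indices outside which all rows and columns vanish. *)
Lemma fmatL a : exists2 L : seq G, uniq L &
  forall r s, (r \notin L) || (s \notin L) -> a (r, s) = 0.
Proof.
have [L _ hL] := fsuppL a.
exists (undup (map fst L ++ map snd L)); first exact: undup_uniq.
move=> r s; rewrite !mem_undup !mem_cat -negb_and => h; apply: hL.
apply: contra h => rs; apply/andP; split; apply/orP; [left|right].
  exact: (map_f fst rs).
exact: (map_f snd rs).
Qed.

Definition fmat_mulf a b : G * G -> B :=
  fun rs => \sum_(t \in [set: G]) a (rs.1, t) ** b (t, rs.2).

Lemma fmat_mulfE a b (L : seq G) r s : uniq L ->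
  (forall t, t \notin L -> a (r, t) = 0 \/ b (t, s) = 0) ->
  fmat_mulf a b (r, s) = \sum_(t <- L) a (r, t) ** b (t, s).
Proof.
move=> uL hL; apply: fsumE => // t /hL [->|->]; by rewrite (nmul0l, nmul0r).
Qed.

Lemma fmat_mul_fin a b : fmat_mulf a b \in @fin_supp k (G * G)%type B.
Proof.
have [L uL hL] := fmatL a; have [L' uL' hL'] := fmatL b.
apply/fin_suppP; exists (undup [seq (r, s) | r <- L, s <- L']).
  exact: undup_uniq.
move=> [r s]; rewrite mem_undup => rs.
rewrite (@fmat_mulfE _ _ [::]) ?big_nil// => t _.
have [rL|rL] := boolP (r \in L); last by left; rewrite hL // rL.
have [sL|sL] := boolP (s \in L'); last by right; rewrite hL' // sL orbT.
by case/negP: rs; apply/allpairsP; exists (r, s).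
Qed.

Definition fmat_mul a b : fmat G B := Fsupp (fmat_mul_fin a b).

Lemma fmat_mulE a b (L : seq G) r s : uniq L ->
  (forall t, t \notin L -> a (r, t) = 0 \/ b (t, s) = 0) ->
  fmat_mul a b (r, s) = \sum_(t <- L) a (r, t) ** b (t, s).
Proof. exact: fmat_mulfE. Qed.

Lemma fmat_mulA : associative fmat_mul.
Proof.
move=> a b c; apply/fsuppP => -[r s].
have [L uL hL] := fmatL b.
rewrite (fmat_mulE (L := L)) //; last first.
  move=> t tL; right; rewrite (fmat_mulE (L := [::])) ?big_nil // => u _.
  by left; rewrite hL // tL.
rewrite (fmat_mulE (L := L)) //; last first.
  move=> t tL; left; rewrite (fmat_mulE (L := [::])) ?big_nil // => u _.
  by right; rewrite hL // tL orbT.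
under eq_bigr => t _.
  rewrite (fmat_mulE (L := L)) //; last first.
    by move=> u uLL; left; rewrite hL // uLL orbT.
  rewrite (lin_sum (nmul_linearr _)); over.
rewrite exchange_big; apply: eq_bigr => t _.
rewrite (fmat_mulE (L := L)) //; last first.
  by move=> u uLL; right; rewrite hL // uLL.
rewrite (lin_sum (nmul_linearl _)).
by apply: eq_bigr => u _; rewrite nmulA.
Qed.

Lemma fmat_mul_linearl b : linear (fmat_mul^~ b).
Proof.
move=> x a a'; apply/fsuppP => -[r s].
have [L uL hL] := fmatL b.
have hb t : t \notin L -> b (t, s) = 0 by move=> tL; rewrite hL // tL.
rewrite [RHS](_ : _ = x *: fmat_mul a b (r, s) + fmat_mul a' b (r, s)) //.
rewrite !(fmat_mulE (L := L)) //; try by move=> t tL; right; exact: hb.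
rewrite scaler_sumr -big_split /=; apply: eq_bigr => t _.
exact: (nmul_linearl (b (t, s))).
Qed.

Lemma fmat_mul_linearr a : linear (fmat_mul a).
Proof.
move=> x b b'; apply/fsuppP => -[r s].
have [L uL hL] := fmatL a.
have ha t : t \notin L -> a (r, t) = 0 by move=> tL; rewrite hL // tL orbT.
rewrite [RHS](_ : _ = x *: fmat_mul a b (r, s) + fmat_mul a b' (r, s)) //.
rewrite !(fmat_mulE (L := L)) //; try by move=> t tL; left; exact: ha.
rewrite scaler_sumr -big_split /=; apply: eq_bigr => t _.
exact: (nmul_linearr (a (r, t))).
Qed.

HB.instance Definition _ := LModule_isNUAlgebra.Build k (fmat G B)
  fmat_mulA fmat_mul_linearl fmat_mul_linearr.

Lemma fmat_unitM r s t u (a b : B) :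
  (fdelta (r, s) a : fmat G B) ** (fdelta (t, u) b : fmat G B)
    = if s == t then fdelta (r, u) (a ** b) else 0.
Proof.
apply/fsuppP => -[p q]; rewrite [LHS](fmat_mulE (L := [:: s])) //; last first.
  by move=> v /=; rewrite inE !xpair_eqE => /negbTE ->; rewrite andbF; left.
rewrite big_seq1 /= !xpair_eqE eqxx andbT.
case: (s == t) => /=; last by rewrite nmul0r.
rewrite xpair_eqE; case: (p == r) => /=; last by rewrite nmul0l.
by case: (q == u); rewrite ?nmul0r.
Qed.

End FiniteMatrices.

Record gradedAlg (k : comPzRingType) (G : groupType) := GradedAlg {
  galg_sort :> nuAlgType k;
  grade : G -> set galg_sort;
  grade_direct : direct_sum grade;
  grade_mul : forall s t a b,
    grade s a -> grade t b -> grade (s * t)%g (a ** b)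
}.

Arguments grade {k G} B t _ : rename.

Definition strongly_graded (k : comPzRingType) (G : groupType)
    (B : gradedAlg k G) : Prop :=
  forall r t, span2 (@nmul k B) (grade B r) (grade B t) = grade B (r * t)%g.

(* The smash product B # G: its elements are the matrices whose (r, s) entry
   lies in B_{r^-1 s}. *)
Section SmashProduct.
Variables (k : comPzRingType) (G : groupType) (B : gradedAlg k G).

Definition smash_pred : {pred fmat G B} :=
  fun a => `[< forall r s, grade B (r^-1 * s)%g (a (r, s)) >].

Lemma smash_predP (a : fmat G B) :
  (a \in smash_pred) <-> forall r s, grade B (r^-1 * s)%g (a (r, s)).
Proof. by split=> [/asboolP|h] //; exact/asboolP. Qed.

Lemma grade_submodule t : submodule (grade B t).
Proof. by have [] := grade_direct B. Qed.

Lemma smash_submod : submod_closed smash_pred.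
Proof.
split=> [|x a b /smash_predP ha /smash_predP hb]; apply/smash_predP => r s.
  by case: (grade_submodule (r^-1 * s)%g).
by case: (grade_submodule (r^-1 * s)%g) => _; apply; [exact: ha|exact: hb].
Qed.

Lemma smash_mul_closed (a b : fmat G B) :
  a \in smash_pred -> b \in smash_pred -> a ** b \in smash_pred.
Proof.
move=> /smash_predP ha /smash_predP hb; apply/smash_predP => r s.
have [L uL hL] := fmatL a.
have -> : (a ** b) (r, s) = \sum_(t <- L) a (r, t) ** b (t, s).
  by apply: fmat_mulE => // t tL; left; rewrite hL // tL orbT.
apply: submodule_sum => [|t _]; first exact: grade_submodule.
have := grade_mul (ha r t) (hb t s).
by rewrite -mulgA mulVKg.
Qed.

HB.instance Definition _ := GRing.isSubmodClosed.Build k (fmat G B) smash_pred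
  smash_submod.

Record smash := Smash { smash_val :> fmat G B; smashP : smash_val \in smash_pred }.

HB.instance Definition _ := [isSub for smash_val].
HB.instance Definition _ := [Choice of smash by <:].
HB.instance Definition _ := [SubChoice_isSubLmodule of smash by <:].

Implicit Types a b c : smash.

Definition smash_mul a b : smash := Smash (smash_mul_closed (smashP a) (smashP b)).

Lemma smash_mulA : associative smash_mul.
Proof. by move=> a b c; apply: val_inj; exact: nmulA. Qed.

Lemma smash_mul_linearl b : linear (smash_mul^~ b).
Proof.
by move=> x a a'; apply: val_inj; exact: (nmul_linearl (smash_val b)).
Qed.

Lemma smash_mul_linearr a : linear (smash_mul a).
Proof.
by move=> x b b'; apply: val_inj; exact: (nmul_linearr (smash_val a)).
Qed.

HB.instance Definition _ := LModule_isNUAlgebra.Build k smash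
  smash_mulA smash_mul_linearl smash_mul_linearr.

End SmashProduct.

Notation "B '#' G" := (@smash _ G B) (at level 40) : type_scope.

(* Actions of G on A by algebra automorphisms. *)
Record algAction (k : comPzRingType) (G : groupType) (A : nuAlgType k) := AlgAction {
  aact :> G -> A -> A;
  aact_linear : forall t, linear (aact t);
  aact_nmul : forall t a b, aact t (a ** b) = aact t a ** aact t b;
  aact1 : forall a, aact 1%g a = a;
  aactM : forall s t a, aact (s * t)%g a = aact s (aact t a)
}.

(* beta^B, given by beta_t (b e_{r,s}) = b e_{tr,ts}. *)
Section SmashAction.
Variables (k : comPzRingType) (G : groupType) (B : gradedAlg k G).

Lemma smash_act_fin (t : G) (a : B # G) :
  (fun rs => a (t^-1 * rs.1, t^-1 * rs.2)%g) \in @fin_supp k (G * G)%type B.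
Proof.
have [L uL hL] := fmatL a.
apply/fin_suppP; exists (undup [seq (t * r, t * s)%g | r <- L, s <- L]).
  exact: undup_uniq.
move=> [r s]; rewrite mem_undup => rs /=; apply: hL.
rewrite -negb_and; apply: contra rs => /andP [rL sL].
by apply/allpairsP; exists (t^-1 * r, t^-1 * s)%g; rewrite !mulVKg.
Qed.

Definition smash_act_val (t : G) (a : B # G) : fmat G B := Fsupp (smash_act_fin t a).

Lemma smash_act_closed t a : smash_act_val t a \in @smash_pred k G B.
Proof.
apply/smash_predP => r s /=.
have /smash_predP /(_ (t^-1 * r) (t^-1 * s))%g := smashP a.
by rewrite invgM invgK -mulgA mulVKg.
Qed.

Definition smash_act t a : B # G := Smash (smash_act_closed t a).

Lemma smash_act_linear t : linear (smash_act t).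
Proof. by move=> x a b; apply: val_inj; apply/fsuppP. Qed.

Lemma smash_act_nmul t a b : smash_act t (a ** b) = smash_act t a ** smash_act t b.
Proof.
apply: val_inj; apply/fsuppP => -[r s].
have [L uL hL] := fmatL a.
rewrite [LHS](fmat_mulE (L := L)) //=; last first.
  by move=> u /= uL'; left; rewrite hL // uL' orbT.
rewrite [RHS](fmat_mulE (L := [seq t * u | u <- L]%g)) /=.
- by rewrite big_map; apply: eq_bigr => u _ /=; rewrite mulKg.
- by rewrite map_inj_uniq //; exact: mulgI.
move=> u uL'; left; rewrite hL //; apply/orP; right; apply: contra uL' => uL'.
by rewrite -[u](mulVKg t); exact: map_f.
Qed.

Lemma smash_act1 a : smash_act 1%g a = a.
Proof.
by apply: val_inj; apply/fsuppP => -[r s] /=; rewrite invg1 !mul1g.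
Qed.

Lemma smash_actM s t a : smash_act (s * t)%g a = smash_act s (smash_act t a).
Proof.
by apply: val_inj; apply/fsuppP => -[r u] /=; rewrite invgM !mulgA.
Qed.

Lemma smash_act_unit t r s (b : B) (a : B # G) :
  smash_val a = fdelta (r, s) b ->
  smash_val (smash_act t a) = fdelta (t * r, t * s)%g b.
Proof.
have tE x y : (t^-1 * x == y)%g = (x == t * y)%g.
  by rewrite -[in LHS](inj_eq (mulgI t)) mulVKg.
by move=> ab; apply/fsuppP => -[p q] /=; rewrite ab /= !xpair_eqE !tE.
Qed.

Definition smash_action : algAction G (B # G) :=
  AlgAction smash_act_linear smash_act_nmul smash_act1 smash_actM.

End SmashAction.

(* The skew group algebra of an action; c delta_t is fdelta t c. *)
Definition skew (k : comPzRingType) (G : groupType) (A : nuAlgType k)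
    (act : algAction G A) : Type := fsupp G A.

Identity Coercion fsupp_of_skew : skew >-> fsupp.

Section SkewGroupAlgebra.
Variables (k : comPzRingType) (G : groupType) (A : nuAlgType k).
Variable act : algAction G A.
Implicit Types a b c : skew act.

HB.instance Definition _ := GRing.Lmodule.on (skew act).

Let act0 t : act t 0 = 0. Proof. exact: (lin0 (aact_linear act t)). Qed.

Definition skew_mulf a b : G -> A :=
  fun u => \sum_(s \in [set: G]) a s ** act s (b (s^-1 * u)%g).

Lemma skew_mulfE a b (L : seq G) u : uniq L ->
  (forall s, s \notin L -> a s = 0 \/ b (s^-1 * u)%g = 0) ->
  skew_mulf a b u = \sum_(s <- L) a s ** act s (b (s^-1 * u)%g).
Proof.
move=> uL hL; apply: fsumE => // s /hL [->|->]; first by rewrite nmul0l.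
by rewrite act0 nmul0r.
Qed.

Lemma skew_mul_fin a b : skew_mulf a b \in @fin_supp k G A.
Proof.
have [L uL hL] := fsuppL a; have [L' uL' hL'] := fsuppL b.
apply/fin_suppP; exists (undup [seq (s * t)%g | s <- L, t <- L']).
  exact: undup_uniq.
move=> u; rewrite mem_undup => uLL.
rewrite (@skew_mulfE _ _ [::]) ?big_nil // => s _.
have [sL|sL] := boolP (s \in L); last by left; exact: hL.
right; apply: hL'; apply: contra uLL => sL'.
by apply/allpairsP; exists (s, s^-1 * u)%g; rewrite mulVKg.
Qed.

Definition skew_mul a b : skew act := Fsupp (skew_mul_fin a b).

Lemma skew_mulE a b (L : seq G) u : uniq L ->
  (forall s, s \notin L -> a s = 0 \/ b (s^-1 * u)%g = 0) ->
  skew_mul a b u = \sum_(s <- L) a s ** act s (b (s^-1 * u)%g).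
Proof. exact: skew_mulfE. Qed.

Lemma skew_mulA : associative skew_mul.
Proof.
move=> a b c; apply/fsuppP => w.
have [L uL hL] := fsuppL a; have [L' uL' hL'] := fsuppL b.
pose LL := undup [seq (s * t)%g | s <- L, t <- L'].
have uLL : uniq LL := undup_uniq _.
have inLL s t : s \in L -> t \in L' -> (s * t)%g \in LL.
  by move=> sL tL; rewrite mem_undup; apply/allpairsP; exists (s, t).
rewrite [LHS](skew_mulE (L := L)) //; last by move=> s /hL ->; left.
rewrite [RHS](skew_mulE (L := LL)) //; last first.
  move=> u uL''; left; rewrite (skew_mulE (L := L)) //; last first.
    by move=> s /hL ->; left.
  rewrite big1_seq // => s /andP [_ sL]; rewrite hL' ?act0 ?nmul0r //.
  by apply: contra uL'' => sL'; rewrite -[u](mulVKg s); exact: inLL.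
under [RHS]eq_bigr => u _.
  rewrite (skew_mulE (L := L)) //; last by move=> s /hL ->; left.
  rewrite (lin_sum (nmul_linearl _)); over.
rewrite [RHS]exchange_big; apply: eq_big_seq => s sL.
rewrite (skew_mulE (L := L')) //; last by move=> t /hL' ->; left.
rewrite (lin_sum (aact_linear act s)) (lin_sum (nmul_linearr _)).
have sub : {subset [seq (s * t)%g | t <- L'] <= LL}.
  by move=> u /mapP [t tL ->]; exact: inLL.
have usL : uniq [seq (s * t)%g | t <- L'].
  by rewrite map_inj_uniq //; exact: mulgI.
rewrite [RHS](bigID (mem [seq (s * t)%g | t <- L'])).
rewrite /= [X in _ = _ + X]big1 ?addr0; last first.
  move=> u uL''; rewrite hL' ?act0 ?nmul0r ?nmul0l //.
  by apply: contra uL'' => sL'; rewrite -[u](mulVKg s); exact: map_f.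
rewrite -[RHS]big_filter.
have perm_sL : perm_eq [seq u <- LL | u \in [seq (s * t)%g | t <- L']]
                       [seq (s * t)%g | t <- L'].
  apply: uniq_perm => // [|u]; first by rewrite filter_uniq.
  by rewrite mem_filter; apply/andP/idP => [[]//|usL']; split=> //; exact: sub.
rewrite (perm_big _ perm_sL) big_map; apply: eq_bigr => t _.
by rewrite aact_nmul nmulA -aactM mulKg invgM mulgA.
Qed.

Lemma skew_mul_linearl b : linear (skew_mul^~ b).
Proof.
move=> x a a'; apply/fsuppP => u.
have [L uL hL] := fsuppL a; have [L' uL' hL'] := fsuppL a'.
pose M := undup (L ++ L'); have uM : uniq M := undup_uniq _.
have hM s : s \notin M -> a s = 0 /\ a' s = 0.
  by rewrite mem_undup mem_cat negb_or => /andP [/hL -> /hL' ->].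
rewrite [RHS](_ : _ = x *: skew_mul a b u + skew_mul a' b u) //.
rewrite !(skew_mulE (L := M)) //; try by move=> s /hM [h h']; left.
  rewrite scaler_sumr -big_split /=; apply: eq_bigr => s _.
  exact: (nmul_linearl (act s (b (s^-1 * u)%g))).
move=> s /hM [h h']; left; rewrite [LHS](_ : _ = x *: a s + a' s) //.
by rewrite h h' scaler0 addr0.
Qed.

Lemma skew_mul_linearr a : linear (skew_mul a).
Proof.
move=> x b b'; apply/fsuppP => u; have [L uL hL] := fsuppL a.
rewrite [RHS](_ : _ = x *: skew_mul a b u + skew_mul a b' u) //.
rewrite !(skew_mulE (L := L)) //; try by move=> s /hL ->; left.
rewrite scaler_sumr -big_split /=; apply: eq_bigr => s _.
rewrite -(nmul_linearr (a s)) -(aact_linear act s) //.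
Qed.

HB.instance Definition _ := LModule_isNUAlgebra.Build k (skew act)
  skew_mulA skew_mul_linearl skew_mul_linearr.

Lemma skew_deltaM s t (c d : A) :
  (fdelta s c : skew act) ** (fdelta t d : skew act)
    = fdelta (s * t)%g (c ** act s d).
Proof.
apply/fsuppP => u; rewrite [LHS](skew_mulE (L := [:: s])) //; last first.
  by move=> v /=; rewrite inE => /negbTE ->; left.
rewrite big_seq1 /= eqxx -(inj_eq (mulgI s)) mulVKg.
by case: eqP => // _; rewrite act0 nmul0r.
Qed.

Definition skew_grade (t : G) : set (skew act) :=
  [set a | forall s, s != t -> a s = 0].

Lemma skew_grade_direct : direct_sum skew_grade.
Proof.
split=> [t|a].
  split=> [s _ //|x a b ha hb s st].
  by rewrite [LHS](_ : _ = x *: a s + b s) // ha // hb // scaler0 addr0.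
have [L uL hL] := fsuppL a.
have fin : (fun t => fdelta t (a t) : skew act) \in @fin_supp k G (skew act).
  apply/fin_suppP; exists L => // t tL; apply/fsuppP => s /=.
  by rewrite hL // if_same.
exists (Fsupp fin); split=> [|f [hf af]].
  split=> [t s /= /negbTE ->//|].
  rewrite [RHS](fsumE uL); first exact: fsupp_decomp.
  by move=> t tL; apply/fsuppP => s /=; rewrite hL // if_same.
apply/fsuppP => t; apply/fsuppP => s /=.
have [Lf uLf hLf] := fsuppL f.
have -> : a t = f t t.
  rewrite af (fsumE uLf hLf) fsupp_sumE.
  have [tL|tL] := boolP (t \in Lf).
    rewrite (bigD1_seq t) //= big1 ?addr0 // => u ut; apply: hf.
    by rewrite eq_sym.
  rewrite hLf // big1_seq // => u /andP [_ uLf']; apply: hf.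
  by apply: contra tL => /eqP ->.
by case: (eqVneq s t) => [->//|/hf ->].
Qed.

Lemma skew_grade_mul s t a b :
  skew_grade s a -> skew_grade t b -> skew_grade (s * t)%g (a ** b).
Proof.
move=> ha hb u ust; apply: (etrans (skew_mulE (L := [::]) _ _)) => //.
  move=> v _; have [vs|/ha ->] := eqVneq v s; last by left.
  right; apply: hb; apply: contra ust => /eqP <-.
  by rewrite vs mulVKg.
by rewrite big_nil.
Qed.

Definition skew_group_alg : gradedAlg k G :=
  GradedAlg skew_grade_direct skew_grade_mul.

End SkewGroupAlgebra.

(* The quotient of a module M by the submodule spanned by a set S. *)
Section QuotientModule.
Variables (k : comPzRingType) (M : lmodType k) (S : set M).

Definition span_pred : {pred M} := fun x => `[< span S x >].

Lemma span_pred_submod : submod_closed span_pred.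
Proof.
have [S0 hS] := span_submodule S.
split=> [|a u v /asboolP uS /asboolP vS]; apply/asboolP => //; exact: hS.
Qed.

HB.instance Definition _ := GRing.isSubmodClosed.Build k M span_pred
  span_pred_submod.

Definition lquot : Type := Quotient.quot span_pred.

HB.instance Definition _ := GRing.Zmodule.on lquot.

Definition lproj (x : M) : lquot := \pi_(Quotient.quot span_pred)%qT x.

Lemma lproj_eq x y : lproj x = lproj y <-> span S (x - y).
Proof.
split=> [/eqP|h].
  by rewrite -Quotient.idealrBE => /asboolP.
by apply/eqP; rewrite -Quotient.idealrBE; exact/asboolP.
Qed.

Lemma lproj_repr (z : lquot) : lproj (repr z) = z.
Proof. exact: reprK. Qed.

Lemma lproj_surj (z : lquot) : exists x, lproj x = z.
Proof. by exists (repr z); exact: lproj_repr. Qed.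

Definition lquot_scale (a : k) (z : lquot) : lquot := lproj (a *: repr z).

Lemma lprojZ a x : lquot_scale a (lproj x) = lproj (a *: x).
Proof.
apply/lproj_eq; rewrite -scalerBr; apply: (submoduleZ a (span_submodule S)).
by apply: (lproj_eq _ _).1; exact: lproj_repr.
Qed.

Lemma lprojD x y : lproj (x + y) = lproj x + lproj y.
Proof. exact: raddfD. Qed.

Lemma lquot_scalerA a b z :
  lquot_scale a (lquot_scale b z) = lquot_scale (a * b) z.
Proof. by have [x <-] := lproj_surj z; rewrite !lprojZ scalerA. Qed.

Lemma lquot_scale1 : left_id 1 lquot_scale.
Proof. by move=> z; have [x <-] := lproj_surj z; rewrite lprojZ scale1r. Qed.

Lemma lquot_scalerDr : right_distributive lquot_scale +%R.
Proof.
move=> a z w; have [x <-] := lproj_surj z; have [y <-] := lproj_surj w.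
by rewrite -lprojD !lprojZ -lprojD scalerDr.
Qed.

Lemma lquot_scalerDl z : {morph lquot_scale^~ z : a b / a + b}.
Proof.
move=> a b; have [x <-] := lproj_surj z.
by rewrite !lprojZ -lprojD scalerDl.
Qed.

HB.instance Definition _ := GRing.Zmodule_isLmodule.Build k lquot
  lquot_scalerA lquot_scale1 lquot_scalerDr lquot_scalerDl.

Lemma lproj_linear : linear lproj.
Proof. by move=> a x y; rewrite lprojD -lprojZ. Qed.

Lemma lproj0 x : span S x -> lproj x = 0.
Proof. by move=> xS; rewrite -(lin0 lproj_linear); apply/lproj_eq; rewrite subr0. Qed.

Variables (V : lmodType k) (f : M -> V).
Hypotheses (f_linear : linear f) (f_S : forall x, S x -> f x = 0).

Definition lquot_lift (z : lquot) : V := f (repr z).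

Lemma lquot_liftE x : lquot_lift (lproj x) = f x.
Proof.
apply/eqP; rewrite -subr_eq0 -scaleN1r addrC -(f_linear (-1)) scaleN1r addrC.
apply/eqP; have : span S (repr (lproj x) - x).
  by apply: (lproj_eq _ _).1; exact: lproj_repr.
apply: (span_sub (U := f @^-1` [set 0])) => //.
apply: (submodule_preim f_linear).
by split=> // a u v /= -> ->; rewrite scaler0 addr0.
Qed.

Lemma lquot_lift_linear : linear lquot_lift.
Proof.
move=> a z w; have [x <-] := lproj_surj z; have [y <-] := lproj_surj w.
by rewrite -lproj_linear !lquot_liftE f_linear.
Qed.

End QuotientModule.

(* Unitality, i.e. A X = X = X B, is not assumed. *)
Record bimod (k : comPzRingType) (A B : nuAlgType k) := Bimod {
  bimod_sort :> lmodType k;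
  lact : A -> bimod_sort -> bimod_sort;
  ract : bimod_sort -> B -> bimod_sort;
  lact_linearl : forall x, linear (lact^~ x);
  lact_linearr : forall a, linear (lact a);
  ract_linearl : forall b, linear (ract^~ b);
  ract_linearr : forall x, linear (ract x);
  lactA : forall a a' x, lact (a ** a') x = lact a (lact a' x);
  ractA : forall x b b', ract x (b ** b') = ract (ract x b) b';
  lractA : forall a x b, ract (lact a x) b = lact a (ract x b)
}.

Definition regular_bimod (k : comPzRingType) (A : nuAlgType k) : bimod A A :=
  @Bimod k A A A (@nmul k A) (@nmul k A)
    nmul_linearl nmul_linearr nmul_linearl nmul_linearr
    (fun a a' x => esym (nmulA a a' x)) (@nmulA k A)
    (fun a x b => esym (nmulA a x b)).

Definition bimod_hom (k : comPzRingType) (A B : nuAlgType k) (X Y : bimod A B)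
    (f : X -> Y) : Prop :=
  [/\ linear f, forall a x, f (lact a x) = lact a (f x)
    & forall x b, f (ract x b) = ract (f x) b].

(* X (x)_B Y, as a quotient of the free k-module on X x Y. *)
Section TensorProduct.
Variables (k : comPzRingType) (A B C : nuAlgType k).
Variables (X : bimod A B) (Y : bimod B C).

Local Notation free_tens := (fsupp (X * Y)%type k^o).

Definition free_gen (x : X) (y : Y) : free_tens := fdelta (x, y) (1 : k^o).

Definition tens_rel : set free_tens := [set z |
  [\/ exists a x x' y,
        z = free_gen (a *: x + x') y - (a *: free_gen x y + free_gen x' y),
      exists a x y y',
        z = free_gen x (a *: y + y') - (a *: free_gen x y + free_gen x y')
    | exists x b y, z = free_gen (ract x b) y - free_gen x (lact b y)]].

Definition tensor : lmodType k := lquot tens_rel.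

Definition tens (x : X) (y : Y) : tensor := lproj tens_rel (free_gen x y).

Let tens_relP u v : tens_rel (u - v) -> lproj tens_rel u = lproj tens_rel v.
Proof. by move=> h; apply/lproj_eq; exact: sub_span. Qed.

Lemma tens_linearl y : linear (tens^~ y).
Proof.
move=> a x x'; rewrite -(lproj_linear tens_rel); apply: tens_relP.
by apply: Or31; exists a, x, x', y.
Qed.

Lemma tens_linearr x : linear (tens x).
Proof.
move=> a y y'; rewrite -(lproj_linear tens_rel); apply: tens_relP.
by apply: Or32; exists a, x, y, y'.
Qed.

Lemma tens_balanced x b y : tens (ract x b) y = tens x (lact b y).
Proof. by apply: tens_relP; apply: Or33; exists x, b, y. Qed.

Lemma tens_ind (P : set tensor) :
  submodule P -> (forall x y, P (tens x y)) -> forall z, P z.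
Proof.
move=> hP hxy z; have [f <-] := lproj_surj z.
have [L uL hL] := fsuppL f.
rewrite (fsupp_decomp uL hL) (lin_sum (lproj_linear _)).
apply: submodule_sum => // -[x y] _.
rewrite (_ : fdelta _ _ = (f (x, y) : k) *: free_gen x y); last first.
  apply/fsuppP => p; rewrite fsuppZE /=; case: ifP => _; apply: esym.
    exact (mulr1 (f (x, y) : k)).
  exact (mulr0 (f (x, y) : k)).
by rewrite (linZ (lproj_linear _)); apply: (submoduleZ _ hP); exact: hxy.
Qed.

(* The linear map sending x (x) y to f x y, for f bilinear and balanced. *)
Section Lift.
Variables (V : lmodType k) (f : X -> Y -> V).

Definition free_lift (z : free_tens) : V :=
  \sum_(p \in [set: (X * Y)%type]) (z p : k) *: f p.1 p.2.

Lemma free_liftE (z : free_tens) (L : seq (X * Y)%type) :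
  uniq L -> (forall p, p \notin L -> z p = 0) ->
  free_lift z = \sum_(p <- L) (z p : k) *: f p.1 p.2.
Proof. by move=> uL hL; apply: (fsumE uL) => p /hL ->; rewrite scale0r. Qed.

Lemma free_lift_linear : linear free_lift.
Proof.
move=> a z w; have [L uL hL] := fsuppL z; have [L' uL' hL'] := fsuppL w.
pose M := undup (L ++ L'); have uM : uniq M := undup_uniq _.
have hM p : p \notin M -> z p = 0 /\ w p = 0.
  by rewrite mem_undup mem_cat negb_or => /andP [/hL -> /hL' ->].
rewrite !(free_liftE (L := M)) //; try by move=> p /hM [].
  rewrite scaler_sumr -big_split; apply: eq_bigr => p _.
  rewrite fsuppDE fsuppZE [LHS]scalerDl; congr (_ + _).
  exact: esym (scalerA a (z p : k) _).
by move=> p /hM [zp wp]; rewrite fsuppDE fsuppZE zp wp scaler0 addr0.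
Qed.

Lemma free_lift_gen x y : free_lift (free_gen x y) = f x y.
Proof.
rewrite (free_liftE (L := [:: (x, y)])) // => [|p].
  by rewrite big_seq1 /= eqxx scale1r.
by rewrite inE /= => /negbTE ->.
Qed.

Definition tens_lift : tensor -> V := lquot_lift free_lift.

Hypothesis f_linearl : forall y, linear (f^~ y).
Hypothesis f_linearr : forall x, linear (f x).
Hypothesis f_balanced : forall x b y, f (ract x b) y = f x (lact b y).

Let free_lift_rel z : tens_rel z -> free_lift z = 0.
Proof.
have hB u v : free_lift (u - v) = free_lift u - free_lift v.
  by rewrite addrC -[- v]scaleN1r free_lift_linear scaleN1r addrC.
case=> [[a [x [x' [y ->]]]]|[a [x [y [y' ->]]]]|[x [b [y ->]]]];
  rewrite hB ?free_lift_linear !free_lift_gen.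
- by rewrite f_linearl subrr.
- by rewrite f_linearr subrr.
- by rewrite f_balanced subrr.
Qed.

Lemma tens_liftE x y : tens_lift (tens x y) = f x y.
Proof.
by rewrite -free_lift_gen; exact: lquot_liftE free_lift_linear free_lift_rel _.
Qed.

Lemma tens_lift_linear : linear tens_lift.
Proof. exact: lquot_lift_linear free_lift_linear free_lift_rel. Qed.

End Lift.

Lemma tens_lift_ext (V : lmodType k) (f g : tensor -> V) :
  linear f -> linear g -> (forall x y, f (tens x y) = g (tens x y)) -> f =1 g.
Proof.
move=> f_lin g_lin fg; apply: (tens_ind (P := [set z | f z = g z])) => //.
split=> [|a u v /= hu hv] /=; first by rewrite (lin0 f_lin) (lin0 g_lin).
by rewrite f_lin g_lin hu hv.
Qed.

Definition tens_lact (a : A) : tensor -> tensor :=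
  tens_lift (fun x y => tens (lact a x) y).

Definition tens_ract (z : tensor) (c : C) : tensor :=
  tens_lift (fun x y => tens x (ract y c)) z.

Let tens_lactP a :
  (forall x y, tens_lact a (tens x y) = tens (lact a x) y) * linear (tens_lact a).
Proof.
have hl (y : Y) : linear (fun x => tens (lact a x) y).
  by move=> c x x'; rewrite lact_linearr tens_linearl.
have hr (x : X) : linear (fun y => tens (lact a x) y) by exact: tens_linearr.
have hb (x : X) b (y : Y) :
    tens (lact a (ract x b)) y = tens (lact a x) (lact b y).
  by rewrite -lractA tens_balanced.
split=> [x y|]; first exact: tens_liftE hl hr hb x y.
exact: tens_lift_linear hl hr hb.
Qed.

Let tens_ractP c :
  (forall x y, tens_ract (tens x y) c = tens x (ract y c)) * linear (tens_ract^~ c).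
Proof.
have hl (y : Y) : linear (fun x => tens x (ract y c)) by exact: tens_linearl.
have hr (x : X) : linear (fun y => tens x (ract y c)).
  by move=> a y y'; rewrite ract_linearl tens_linearr.
have hb (x : X) b (y : Y) :
    tens (ract x b) (ract y c) = tens x (ract (lact b y) c).
  by rewrite tens_balanced lractA.
split=> [x y|]; first exact: tens_liftE hl hr hb x y.
exact: tens_lift_linear hl hr hb.
Qed.

Lemma tens_lactE a x y : tens_lact a (tens x y) = tens (lact a x) y.
Proof. exact: (tens_lactP a).1. Qed.

Lemma tens_lact_linearr a : linear (tens_lact a).
Proof. exact: (tens_lactP a).2. Qed.

Lemma tens_ractE x y c : tens_ract (tens x y) c = tens x (ract y c).
Proof. exact: (tens_ractP c).1. Qed.

Lemma tens_ract_linearl c : linear (tens_ract^~ c).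
Proof. exact: (tens_ractP c).2. Qed.

Let comp_linear (U V W : lmodType k) (f : U -> V) (g : V -> W) :
  linear f -> linear g -> linear (fun u => g (f u)).
Proof. by move=> hf hg a u v; rewrite hf hg. Qed.

Let comb_linear (U V : lmodType k) (r : k) (f g : U -> V) :
  linear f -> linear g -> linear (fun u => r *: f u + g u).
Proof.
move=> hf hg a u v; rewrite hf hg !scalerDr !scalerA (mulrC r a).
by rewrite addrACA.
Qed.

Lemma tens_lact_linearl z : linear (tens_lact^~ z).
Proof.
move=> r a a' /=; move: z.
apply: tens_lift_ext; [exact: tens_lact_linearr| |].
  by apply: comb_linear; exact: tens_lact_linearr.
by move=> x y; rewrite !tens_lactE lact_linearl tens_linearl.
Qed.

Lemma tens_ract_linearr z : linear (tens_ract z).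
Proof.
move=> r c c'; move: z.
apply: tens_lift_ext; [exact: tens_ract_linearl| |].
  by apply: comb_linear; exact: tens_ract_linearl.
by move=> x y; rewrite !tens_ractE ract_linearr tens_linearr.
Qed.

Lemma tens_lactA a a' z : tens_lact (a ** a') z = tens_lact a (tens_lact a' z).
Proof.
move: z; apply: tens_lift_ext; first exact: tens_lact_linearr.
  by apply: comp_linear; exact: tens_lact_linearr.
by move=> x y; rewrite !tens_lactE lactA.
Qed.

Lemma tens_ractA z c c' : tens_ract z (c ** c') = tens_ract (tens_ract z c) c'.
Proof.
move: z; apply: tens_lift_ext; first exact: tens_ract_linearl.
  by apply: comp_linear; exact: tens_ract_linearl.
by move=> x y; rewrite !tens_ractE ractA.
Qed.

Lemma tens_lractA a z c :
  tens_ract (tens_lact a z) c = tens_lact a (tens_ract z c).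
Proof.
move: z; apply: tens_lift_ext.
- by apply: comp_linear; [exact: tens_lact_linearr|exact: tens_ract_linearl].
- by apply: comp_linear; [exact: tens_ract_linearl|exact: tens_lact_linearr].
by move=> x y; rewrite !(tens_lactE, tens_ractE).
Qed.

Definition tensor_bimod : bimod A C :=
  Bimod tens_lact_linearl tens_lact_linearr tens_ract_linearl tens_ract_linearr
    tens_lactA tens_ractA tens_lractA.

End TensorProduct.

Record moritaContext (k : comPzRingType) (A B : nuAlgType k)
    (X : bimod A B) (Y : bimod B A) := MoritaContext {
  tauA : tensor X Y -> A;
  tauB : tensor Y X -> B;
  tauA_hom : bimod_hom (X := tensor_bimod X Y) (Y := regular_bimod A) tauA;
  tauB_hom : bimod_hom (X := tensor_bimod Y X) (Y := regular_bimod B) tauB;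
  tauAB : forall x y x', lact (tauA (tens x y)) x' = ract x (tauB (tens y x'));
  tauBA : forall y x y', lact (tauB (tens y x)) y' = ract y (tauA (tens x y'))
}.

Record gradedBimod (k : comPzRingType) (G : groupType) (A B : gradedAlg k G) :=
  GradedBimod {
    gbimod_sort :> bimod A B;
    bgrade : G -> set gbimod_sort;
    bgrade_direct : direct_sum bgrade;
    bgrade_lact : forall s t a x,
      grade A s a -> bgrade t x -> bgrade (s * t)%g (lact a x);
    bgrade_ract : forall s t x b,
      bgrade s x -> grade B t b -> bgrade (s * t)%g (ract x b)
  }.

Arguments bgrade {k G A B} X t _ : rename.

(* D^A_t = A_t A_{t^-1}. *)
Definition grade_ideal (k : comPzRingType) (G : groupType) (A : gradedAlg k G)
    (t : G) : set A :=
  span2 (@nmul k A) (grade A t) (grade A t^-1%g).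

Arguments grade_ideal {k G} A t _ : rename.

Definition grade_ideals_idempotent (k : comPzRingType) (G : groupType)
    (A : gradedAlg k G) : Prop :=
  forall t, span2 (@nmul k A) (grade_ideal A t) (grade_ideal A t)
            = grade_ideal A t.

(* X_t is automatically a (D^A_t, D^B_{t^-1})-bimodule, since the two ideals lie
   in A_1 and B_1; only its being unital is a condition. *)
Definition strong_bimod (k : comPzRingType) (G : groupType)
    (A B : gradedAlg k G) (X : gradedBimod A B) : Prop :=
  forall t,
    span2 (@lact k A B X) (grade_ideal A t) (bgrade X t) = bgrade X t /\
    span2 (@ract k A B X) (bgrade X t) (grade_ideal B t^-1%g) = bgrade X t.

Section GradedContext.
Variables (k : comPzRingType) (G : groupType) (A B : gradedAlg k G).
Variables (X : gradedBimod A B) (Y : gradedBimod B A).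
Variable c : moritaContext X Y.

Definition graded_context : Prop :=
  (forall r s x y, bgrade X r x -> bgrade Y s y ->
     grade A (r * s)%g (tauA c (tens x y))) /\
  (forall r s y x, bgrade Y r y -> bgrade X s x ->
     grade B (r * s)%g (tauB c (tens y x))).

Definition context_surjective : Prop :=
  (forall a, exists z, tauA c z = a) /\ (forall b, exists z, tauB c z = b).

Definition context_full : Prop :=
  forall t,
    span2 (fun x y => tauA c (tens x y)) (bgrade X t) (bgrade Y t^-1%g)
      = grade_ideal A t /\
    span2 (fun y x => tauB c (tens y x)) (bgrade Y t) (bgrade X t^-1%g)
      = grade_ideal B t.

End GradedContext.

(* The relation is meant between idempotent algebras whose ideals D_t are all
   idempotent; these requirements are part of the definition. *)
Definition strongly_graded_equivalent (k : comPzRingType) (G : groupType)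
    (A B : gradedAlg k G) : Prop :=
  [/\ idempotent_alg A, idempotent_alg B,
      grade_ideals_idempotent A, grade_ideals_idempotent B
    & exists (X : gradedBimod A B) (Y : gradedBimod B A) (c : moritaContext X Y),
        [/\ graded_context c, strong_bimod X, strong_bimod Y,
            context_surjective c & context_full c]].

(* Main.v *)
Require Import Defs.
From HB Require Import structures.
From mathcomp Require Import all_boot all_algebra all_classical.

Set Implicit Arguments.
Unset Strict Implicit.
Unset Printing Implicit Defensive.

Import Defs GRing.Theory.

Local Open Scope classical_set_scope.
Local Open Scope ring_scope.

(** Write [C] for the skew group algebra of the smash product.  The elements
    [b e_{r,tu} delta_t], with [b] homogeneous of degree [r^-1 t u], span it,
    and they multiply like matrix units,
    [(b e_{r,sv} delta_s) (b' e_{v,tu} delta_t) = b b' e_{r,stu} delta_{st}]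
    ([skew_unitM]).  So [C] is the algebra of finite [G x G] matrices over [B],
    the element above being [b] at position [(r, u)], where an entry of degree
    [w] at [(r, u)] has degree [r w u^-1].

    The equivalence is the usual one between an algebra and its matrix algebra:
    [X] is the right ideal of matrices supported in row [1], [Y] the left ideal
    of those supported in column [1], and [B] is their intersection, the corner
    at [(1, 1)], embedded by [corner_emb].  All module structures and both
    pairings are products in [C], so the axioms of a graded Morita context
    reduce to associativity and to gradedness of [C].  As [B] may have no unit,
    the corner is cut out by positions and not by an idempotent.

    Strong gradedness enters through products of entries.  For sets of indices [P] and [Q], let
    [piece P Q t] be the degree [t] elements with rows in [P] and columns in
    [Q].  Since [B_{r^-1 s v} B_{v^-1 t u} = B_{r^-1 s t u}], an entry at
    [(r, u)] is a sum of products through any prescribed middle index [v], hence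
    [piece P Q s] times [piece Q R t] spans [piece P R (st)] as soon as [Q] is
    nonempty ([span2_piece]).  With [P], [Q], [R] equal to [G] or to [{1}] this
    says that [C] is strongly graded, that [X] and [Y] are unital in each
    degree, and that the pairings fill each degree.  For a strongly graded
    algebra each [D_t] is the component of degree [1], which turns these
    equalities into the required conditions. *)

(** * Spans and direct sums *)

Section Span.
Variables (k : comPzRingType) (M N : lmodType k).

Lemma submodule_setI (U V : set M) :
  submodule U -> submodule V -> submodule (U `&` V).
Proof.
move=> [U0 hU] [V0 hV]; split=> // a u v [uU uV] [vU vV].
by split; [exact: hU|exact: hV].
Qed.

Lemma submodule_image (f : M -> N) (U : set M) :
  linear f -> submodule U -> submodule (f @` U).
Proof.
move=> f_lin [U0 hU]; split; first by exists 0; rewrite ?(lin0 f_lin).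
move=> a _ _ [u uU <-] [v vU <-]; exists (a *: u + v); first exact: hU.
exact: f_lin.
Qed.

Lemma span_image (f : M -> N) (S : set M) :
  linear f -> f @` span S = span (f @` S).
Proof.
move=> f_lin; apply/seteqP; split.
  move=> _ [u uS <-]; move: u uS.
  apply: (span_sub (U := f @^-1` span (f @` S))).
    exact: submodule_preim f_lin _ (span_submodule _).
  by move=> u uS; apply: sub_span; exists u.
apply: span_sub; first exact: submodule_image f_lin (span_submodule S).
by move=> _ [u uS <-]; exists u => //; exact: sub_span.
Qed.

Lemma linear_inj (f : M -> N) :
  linear f -> (forall m, f m = 0 -> m = 0) -> injective f.
Proof.
move=> f_lin f0 x y xy; apply/eqP; rewrite -subr_eq0; apply/eqP/f0.
by rewrite -scaleN1r addrC f_lin scaleN1r xy addNr.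
Qed.

End Span.

Section Span2.
Variables (k : comPzRingType) (X Y : Type) (Z : lmodType k).

Lemma span2_gen (f : X -> Y -> Z) (U : set X) (V : set Y) u v :
  U u -> V v -> span2 f U V (f u v).
Proof. by move=> uU vV; apply: sub_span; exists u => //; exists v. Qed.

Lemma span2_sub (f : X -> Y -> Z) (U : set X) (V : set Y) (W : set Z) :
  submodule W -> (forall u v, U u -> V v -> W (f u v)) -> span2 f U V `<=` W.
Proof.
by move=> hW h; apply: span_sub => // _ [u uU [v vV <-]]; exact: h.
Qed.

(** Every action and pairing below becomes, after embedding, a product in one
    algebra [C]; this brings their spans back to spans of products in [C]. *)
Lemma span2_transport (C : nuAlgType k) (f : X -> Y -> Z) (g : X -> C)
    (h : Y -> C) (j : Z -> C) (U : set X) (V : set Y) (W : set Z) :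
  linear j -> injective j -> (forall x y, j (f x y) = g x ** h y) ->
  span2 (@nmul k C) (g @` U) (h @` V) = j @` W -> span2 f U V = W.
Proof.
move=> j_lin j_inj fE hW.
have jE : j @` span2 f U V = j @` W.
  rewrite -hW /span2 (span_image _ j_lin); congr span.
  apply/seteqP; split.
    move=> _ [_ [u uU [v vV <-]] <-]; rewrite fE.
    by exists (g u); [exists u|exists (h v) => //; exists v].
  move=> _ [_ [u uU <-] [_ [v vV <-] <-]].
  by exists (f u v); [exists u => //; exists v|exact: fE].
apply/seteqP; split=> z hz.
  have : (j @` W) (j z) by rewrite -jE; exists z.
  by case=> w wW /j_inj <-.
have : (j @` span2 f U V) (j z) by rewrite jE; exists z.
by case=> w wW /j_inj <-.
Qed.

End Span2.

Section DirectSum.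
Variables (k : comPzRingType) (I : choiceType) (M : lmodType k).
Variables (U : I -> set M) (dU : direct_sum U).

(** The family of homogeneous components of [m]. *)
Definition dcomp (m : M) : fsupp I M := projT1 (cid (dU.2 m)).

Lemma dcomp_in m i : U i (dcomp m i).
Proof. by have [[h _] _] := projT2 (cid (dU.2 m)); exact: h. Qed.

Lemma dcomp_sum m : m = \sum_(i \in [set: I]) dcomp m i.
Proof. by have [[_ h] _] := projT2 (cid (dU.2 m)). Qed.

Lemma dcomp_uniq m (f : fsupp I M) :
  (forall i, U i (f i)) -> m = \sum_(i \in [set: I]) f i -> dcomp m = f.
Proof. by have [_ h] := projT2 (cid (dU.2 m)); move=> hf mf; exact: h. Qed.

Lemma dcomp_linear i : linear (fun m => dcomp m i).
Proof.
move=> a m n; rewrite -[RHS]/((a *: dcomp m + dcomp n) i).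
congr (fsupp_fun _ i); apply: dcomp_uniq => [j|].
  by case: (dU.1 j) => _; apply; exact: dcomp_in.
rewrite {1}(dcomp_sum m) {1}(dcomp_sum n).
have [L uL hL] := fsuppL (dcomp m); have [L' uL' hL'] := fsuppL (dcomp n).
pose K := undup (L ++ L'); have uK : uniq K := undup_uniq _.
have hK j : j \notin K -> dcomp m j = 0 /\ dcomp n j = 0.
  by rewrite mem_undup mem_cat negb_or => /andP [/hL -> /hL' ->].
rewrite !(fsumE uK); try by move=> j /hK [].
  by rewrite scaler_sumr -big_split.
by move=> j /hK [mj nj]; rewrite fsuppDE fsuppZE mj nj scaler0 addr0.
Qed.

Lemma dcomp_homog i m : U i m -> dcomp m = fdelta i m.
Proof.
move=> mi; apply: dcomp_uniq => [j /=|].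
  by case: eqP => [-> //|_]; case: (dU.1 j).
rewrite (fsumE (L := [:: i])) //; first by rewrite big_seq1 /= eqxx.
by move=> j; rewrite inE /= => /negbTE ->.
Qed.

Lemma dcomp_id i m : U i m -> dcomp m i = m.
Proof. by move=> /dcomp_homog ->; rewrite /= eqxx. Qed.

Lemma dcomp_eq0 m : (forall i, dcomp m i = 0) -> m = 0.
Proof.
by move=> m0; rewrite (dcomp_sum m) (fsumE (L := [::])) ?big_nil.
Qed.

Lemma direct_sum_ind (W : set M) :
  submodule W -> (forall i m, U i m -> W m) -> forall m, W m.
Proof.
move=> hW h m; rewrite (dcomp_sum m); have [L uL hL] := fsuppL (dcomp m).
by rewrite (fsumE uL hL); apply: submodule_sum => // i _;
exact: h (dcomp_in m i).
Qed.

(** A submodule that contains the homogeneous components of its elements is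
    graded by its own homogeneous elements; the submodule is given by an
    injection [j], which lets it be a type of its own. *)
Lemma direct_sum_preim (N : lmodType k) (j : N -> M) :
  linear j -> injective j ->
  (forall n i, exists n', j n' = dcomp (j n) i) ->
  direct_sum (fun i => j @^-1` U i).
Proof.
move=> j_lin j_inj hj; split=> [i|n].
  exact: submodule_preim j_lin _ (dU.1 i).
have [F hF] := choice (hj n).
have [L uL hL] := fsuppL (dcomp (j n)).
have F0 i : i \notin L -> F i = 0.
  by move=> iL; apply: j_inj; rewrite hF hL // (lin0 j_lin).
have finF : F \in @fin_supp k I N by apply/fin_suppP; exists L.
exists (Fsupp finF); split=> [|f [fU nf]].
  split=> [i /=|]; first by rewrite hF; exact: dcomp_in.
  apply: j_inj; rewrite (fsumE uL) // (lin_sum j_lin) [LHS]dcomp_sum.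
  by rewrite (fsumE uL hL); apply: eq_bigr => i _; rewrite hF.
have [K uK hK] := fsuppL f.
have fin_jf : (fun i => j (f i)) \in @fin_supp k I M.
  by apply/fin_suppP; exists K => // i /hK ->; exact: lin0 j_lin.
apply/fsuppP => i; apply: j_inj => /=; rewrite hF.
rewrite (dcomp_uniq (f := Fsupp fin_jf)) //= nf (fsumE uK hK) (lin_sum j_lin).
by rewrite (fsumE uK) // => l /hK ->; exact: lin0 j_lin.
Qed.

End DirectSum.

(** * Pairings of bimodules *)

Section BalancedPairing.
Variables (k : comPzRingType) (A B C : nuAlgType k).
Variables (X : bimod A B) (Y : bimod B C) (V : bimod A C) (f : X -> Y -> V).
Hypothesis f_linearl : forall y, linear (f^~ y).
Hypothesis f_linearr : forall x, linear (f x).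
Hypothesis f_balanced : forall x b y, f (ract x b) y = f x (lact b y).
Hypothesis f_lact : forall a x y, f (lact a x) y = lact a (f x y).
Hypothesis f_ract : forall x y c, f x (ract y c) = ract (f x y) c.

Lemma tens_lift_hom :
  bimod_hom (X := tensor_bimod X Y) (Y := V) (tens_lift f).
Proof.
have E := tens_liftE f_linearl f_linearr f_balanced.
have lin := tens_lift_linear f_linearl f_linearr f_balanced.
split=> // [a|z c]; last move: z; apply: tens_lift_ext.
- by move=> r z w; rewrite /= (tens_lact_linearr a) lin.
- by move=> r z w; rewrite lin lact_linearr.
- by move=> x y; rewrite /= tens_lactE !E f_lact.
- by move=> r z w; rewrite /= (tens_ract_linearl c) lin.
- by move=> r z w; rewrite lin ract_linearl.
- by move=> x y; rewrite /= tens_ractE !E f_ract.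
Qed.

End BalancedPairing.

(** * The skew group algebra as a matrix algebra *)

Section Corner.
Variables (k : comPzRingType) (G : groupType) (B : gradedAlg k G).

Notation C := (skew_group_alg (smash_action B)).
Notation comp := (dcomp (grade_direct B)).

(** Taking the component of [b] first makes the matrix with the single entry [b]
    at [(r, s)] a linear function of an arbitrary [b]; on the entries that occur
    in the smash product it changes nothing. *)
Lemma smash_unit_subproof r s (b : B) :
  (fdelta (r, s) (comp b (r^-1 * s)%g) : fmat G B) \in @smash_pred k G B.
Proof.
apply/smash_predP => p q /=; rewrite xpair_eqE.
case: andP => [[/eqP -> /eqP ->]|_]; first exact: dcomp_in.
by case: (grade_submodule B (p^-1 * q)%g).
Qed.

Definition smash_unit r s (b : B) : B # G := Smash (smash_unit_subproof r s b).

Lemma smash_unit_linear r s : linear (smash_unit r s).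
Proof.
move=> a b b'; apply: val_inj; apply/fsuppP => p.
rewrite -[RHS]/(a *: smash_unit r s b p + smash_unit r s b' p) /=.
rewrite (dcomp_linear (grade_direct B)).
by case: eqP => _; rewrite ?scaler0 ?addr0.
Qed.

Lemma smash_unit_homog r s (b : B) :
  grade B (r^-1 * s)%g b -> smash_val (smash_unit r s b) = fdelta (r, s) b.
Proof. by move=> hb /=; rewrite (dcomp_id _ hb). Qed.

(** The matrix unit at position [(r, u)] in degree [t]: a column index [s] of
    the smash product is read as [t^-1 s] in degree [t], which makes the product
    of two such elements an ordinary product of matrix units. *)
Definition skew_unit r t u (b : B) : C := fdelta t (smash_unit r (t * u)%g b).

Lemma skew_unit_linear r t u : linear (skew_unit r t u).
Proof.
move=> a b b'; apply/fsuppP => s.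
rewrite -[RHS]/(a *: skew_unit r t u b s + skew_unit r t u b' s) /=.
by rewrite smash_unit_linear; case: eqP => _; rewrite ?scaler0 ?addr0.
Qed.

Lemma skew_unit_grade r t u b : grade C t (skew_unit r t u b).
Proof. by move=> s /negbTE /= ->. Qed.

(** The action of [s] moves [e_{v,tu}] to [e_{sv,stu}], so the inner indices
    [s v] agree. *)
Lemma skew_unitM r s v t u (b b' : B) :
  grade B (r^-1 * (s * v))%g b -> grade B (v^-1 * (t * u))%g b' ->
  skew_unit r s v b ** skew_unit v t u b' = skew_unit r (s * t)%g u (b ** b').
Proof.
move=> hb hb'; rewrite [LHS]skew_deltaM; congr fdelta; apply: val_inj.
have hbb' : grade B (r^-1 * (s * t * u))%g (b ** b').
  by have := grade_mul hb hb'; rewrite !mulgA mulgK.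
rewrite [RHS](smash_unit_homog hbb').
rewrite [LHS](_ : _ = smash_val (smash_unit r (s * v)%g b)
  ** smash_val (smash_act s (smash_unit v (t * u)%g b'))) //.
rewrite (smash_act_unit s (smash_unit_homog hb')) (smash_unit_homog hb).
by rewrite fmat_unitM eqxx mulgA.
Qed.

Lemma smash_val_linear : linear (@smash_val k G B).
Proof. by []. Qed.

Lemma coef_linear t : linear (fun c : C => (c : skew _) t).
Proof. by []. Qed.

Lemma entry_linear t p : linear (fun c : C => smash_val (c t) p).
Proof. by move=> a c d; rewrite coef_linear smash_val_linear. Qed.

(** The support condition refers to the positions [(r, u)] of [skew_unit], hence
    the column index [t u] in degree [t]. *)
Definition block (P Q : set G) : set C :=
  [set c | forall t r u, ~ (P r /\ Q u) -> smash_val (c t) (r, t * u)%g = 0].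

Lemma block_submodule P Q : submodule (block P Q).
Proof.
split=> [t r u _ //|a c d hc hd t r u ru].
by rewrite (entry_linear t (r, t * u)%g) hc // hd // scaler0 addr0.
Qed.

Lemma block_full c : block setT setT c.
Proof. by move=> t r u /not_andP []; case. Qed.

(** The rows of a product are rows of the left factor and its columns are
    columns of the right factor, whatever the middle indices are; in particular
    a block with all columns is a right ideal and one with all rows a left
    ideal. *)
Lemma blockM P Q Q' R c d :
  block P Q c -> block Q' R d -> block P R (c ** d).
Proof.
move=> hc hd t r u ru.
have [L uL hL] := fsuppL c.
rewrite [X in smash_val X](skew_mulE (L := L)); last 2 first.
- exact: uL.
- by move=> s /hL ->; left.
rewrite (lin_sum smash_val_linear) fsupp_sumE big1 // => s _.
apply: (etrans (fmat_mulE (L := [::]) _ _)) => [//|w _|];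
  last by rewrite big_nil.
have [Pr|Pr] := pselect (P r); last first.
  by left; rewrite -[w](mulVKg s); apply: hc => -[].
by right=> /=; rewrite !mulgA; apply: hd => -[_ Ru]; exact: ru.
Qed.

Lemma block_skew_unit P Q r t u b : P r -> Q u -> block P Q (skew_unit r t u b).
Proof.
move=> Pr Qu s p v pv /=; case: eqP => [->|_ //] /=.
rewrite xpair_eqE (inj_eq (mulgI t)).
by case: andP => [[/eqP pr /eqP vu]|//]; case: pv; rewrite pr vu.
Qed.

Lemma grade_homogE t (c : C) : grade C t c -> c = fdelta t (c t).
Proof. by move=> hc; apply/fsuppP => s /=; case: eqP => [->|/eqP /hc]. Qed.

Lemma dcomp_skew (c : C) t : dcomp (grade_direct C) c t = fdelta t (c t).
Proof.
move: c; apply: (direct_sum_ind (grade_direct C)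
  (W := [set c : C | dcomp (grade_direct C) c t = fdelta t (c t)])).
  split=> [|a c d /= hc hd] /=.
    rewrite (lin0 (dcomp_linear (grade_direct C) t)); apply/fsuppP => s /=.
    by case: eqP.
  rewrite dcomp_linear hc hd; apply/fsuppP => s.
  rewrite [LHS](_ : _ = a *: (fdelta t (c t) : C) s
                        + (fdelta t (d t) : C) s) //=.
  by case: eqP => _; rewrite ?scaler0 ?addr0.
move=> s c hc /=; rewrite (dcomp_homog _ hc) /=; case: eqP => [ts|/eqP ts].
  by rewrite ts; exact: grade_homogE.
by rewrite hc //; apply/fsuppP => u /=; case: eqP.
Qed.

Lemma block_comp P Q (c : C) t : block P Q c -> block P Q (fdelta t (c t)).
Proof. by move=> hc s r u ru /=; case: eqP => [->|_ //]; exact: hc. Qed.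

(** The Peirce pieces of degree [t]. *)
Definition piece P Q t : set C := block P Q `&` grade C t.

Lemma piece_submodule P Q t : submodule (piece P Q t).
Proof. exact: submodule_setI (block_submodule P Q) (grade_submodule C t). Qed.

Lemma pieceTT t : piece setT setT t = grade C t.
Proof.
by apply/seteqP; split=> [c []//|c hc]; split=> //; exact: block_full.
Qed.

Lemma piece_ind P Q t (W : set C) : submodule W ->
  (forall r u b, P r -> Q u -> grade B (r^-1 * (t * u))%g b ->
    W (skew_unit r t u b)) ->
  piece P Q t `<=` W.
Proof.
move=> hW h c [cPQ ct].
have [L uL hL] := fsuppL (smash_val (c t)).
have -> : c = \sum_(p <- L) skew_unit p.1 t (t^-1 * p.2)%g (smash_val (c t) p).
  rewrite {1}(grade_homogE ct); apply/fsuppP => s; rewrite fsupp_sumE /=.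
  case: eqP => _; last by rewrite big1.
  apply: val_inj; rewrite /= (lin_sum smash_val_linear).
  rewrite [LHS](fsupp_decomp uL hL); apply: eq_bigr => -[r w] _ /=.
  rewrite mulVKg (dcomp_id _ (i := (r^-1 * w)%g)) //.
  by have /smash_predP := smashP (c t); apply.
apply: submodule_sum => // -[r w] _ /=.
have [[Pr Qw]|rw] := pselect (P r /\ Q (t^-1 * w)%g).
  apply: h => //; rewrite mulVKg.
  by have /smash_predP := smashP (c t); apply.
rewrite -[w in smash_val _ (r, w)](mulVKg t) cPQ //.
by rewrite (lin0 (skew_unit_linear _ _ _)); case: hW.
Qed.

Lemma block_ind P Q (W : set C) : submodule W ->
  (forall t, piece P Q t `<=` W) -> block P Q `<=` W.
Proof.
move=> hW h c hc; rewrite (dcomp_sum (grade_direct C) c).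
have [L uL hL] := fsuppL (dcomp (grade_direct C) c).
rewrite (fsumE uL hL); apply: submodule_sum => // t _; apply: (h t).
split; last exact: (dcomp_in (grade_direct C)).
by rewrite dcomp_skew; exact: block_comp.
Qed.

(** The degree of an entry at [(r, u)] factors as
    [r^-1 s t u = (r^-1 s v) (v^-1 t u)], so the entry is a sum of products of an
    entry at [(r, v)] and one at [(v, u)]. *)
Lemma span2_piece P Q R v s t : strongly_graded B -> Q v ->
  span2 (@nmul k C) (piece P Q s) (piece Q R t) = piece P R (s * t)%g.
Proof.
move=> sB Qv; apply/seteqP; split.
  apply: span2_sub; first exact: piece_submodule.
  move=> c d [cb cg] [db dg].
  by split; [exact: blockM cb db|exact: grade_mul cg dg].
apply: piece_ind => [|r u b Pr Ru]; first exact: span_submodule.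
have -> : (r^-1 * (s * t * u) = (r^-1 * (s * v)) * (v^-1 * (t * u)))%g.
  by rewrite !mulgA mulgK.
rewrite -sB; set S := span2 _ _ (piece _ _ _).
suff hS : span2 (@nmul k B) (grade B (r^-1 * (s * v))%g)
    (grade B (v^-1 * (t * u))%g) `<=` skew_unit r (s * t)%g u @^-1` S.
  exact: hS.
apply: span2_sub.
  exact: (submodule_preim (skew_unit_linear _ _ _) (span_submodule _)).
move=> c d hc hd /=; rewrite -(skew_unitM hc hd).
by apply: span2_gen; split; (exact: block_skew_unit || exact: skew_unit_grade).
Qed.

(** * The embedding of B as the corner at the identity *)

Lemma corner_emb_fin (b : B) :
  (fun t => smash_unit 1%g t b) \in @fin_supp k G (B # G).
Proof.
have [L uL hL] := fsuppL (comp b); apply/fin_suppP; exists L => // t tL.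
by apply: val_inj; apply/fsuppP => p /=; rewrite invg1 mul1g hL //; case: eqP.
Qed.

(** A homogeneous [b] of degree [t] goes to [b e_{1,t} delta_t]. *)
Definition corner_emb (b : B) : C := Fsupp (corner_emb_fin b).

Lemma corner_emb_linear : linear corner_emb.
Proof. by move=> a b b'; apply/fsuppP => t; exact: smash_unit_linear. Qed.

Let corner_emb0 : corner_emb 0 = 0. Proof. exact: lin0 corner_emb_linear. Qed.

Lemma corner_emb_homog t b :
  grade B t b -> corner_emb b = skew_unit 1%g t 1%g b.
Proof.
move=> hb; apply/fsuppP => s /=; rewrite mulg1.
case: eqP => [->//|/eqP /negbTE st]; apply: val_inj; apply/fsuppP => p /=.
by rewrite invg1 mul1g (dcomp_homog _ hb) /= st; case: eqP.
Qed.

Lemma corner_emb_inj : injective corner_emb.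
Proof.
apply: (linear_inj corner_emb_linear) => b b0.
apply: (dcomp_eq0 (dU := grade_direct B)) => t.
have : smash_val (corner_emb b t) (1%g, t) = 0 by rewrite b0.
by rewrite /= eqxx invg1 mul1g.
Qed.

Lemma corner_embM b b' : corner_emb (b ** b') = corner_emb b ** corner_emb b'.
Proof.
move: b; apply: (direct_sum_ind (grade_direct B)
  (W := [set b | corner_emb (b ** b') = corner_emb b ** corner_emb b'])).
  split=> [|a b c /= hb hc] /=; first by rewrite !(nmul0l, corner_emb0).
  by rewrite nmul_linearl !corner_emb_linear nmul_linearl hb hc.
move=> s b hb /=; move: b'; apply: (direct_sum_ind (grade_direct B)
  (W := [set b' | corner_emb (b ** b') = corner_emb b ** corner_emb b'])).
  split=> [|a b1 b2 /= h1 h2] /=; first by rewrite !(nmul0r, corner_emb0).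
  by rewrite nmul_linearr !corner_emb_linear nmul_linearr h1 h2.
move=> t b' hb' /=; rewrite (corner_emb_homog (grade_mul hb hb')).
rewrite (corner_emb_homog hb) (corner_emb_homog hb').
by rewrite skew_unitM // invg1 mul1g mulg1.
Qed.

Lemma corner_emb_piece t :
  corner_emb @` grade B t = piece [set 1%g] [set 1%g] t.
Proof.
apply/seteqP; split.
  move=> _ [b hb <-]; rewrite (corner_emb_homog hb).
  by split; [exact: block_skew_unit|exact: skew_unit_grade].
apply: piece_ind.
  exact: submodule_image corner_emb_linear (grade_submodule B t).
move=> _ _ b -> ->; rewrite invg1 mul1g mulg1 => hb.
by exists b => //; exact: corner_emb_homog.
Qed.

Lemma corner_emb_range : range corner_emb = block [set 1%g] [set 1%g].
Proof.
apply/seteqP; split.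
  move=> _ [b _ <-]; move: b; apply: (direct_sum_ind (grade_direct B)
    (W := corner_emb @^-1` block _ _)).
    exact: submodule_preim corner_emb_linear _ (block_submodule _ _).
  move=> t b hb /=; have : (corner_emb @` grade B t) (corner_emb b) by exists b.
  by rewrite corner_emb_piece => -[].
apply: block_ind => [|t].
  by apply: submodule_image corner_emb_linear _.
by rewrite -corner_emb_piece => _ [b _ <-]; exists b.
Qed.

(** * Row and column bimodules *)

Definition corner_pred (P Q : set G) : {pred C} := fun c => `[< block P Q c >].

Lemma corner_submod P Q : submod_closed (corner_pred P Q).
Proof.
have [b0 hb] := block_submodule P Q.
by split=> [|a c d /asboolP hc /asboolP hd]; apply/asboolP => //; exact: hb.
Qed.

HB.instance Definition _ P Q :=
  GRing.isSubmodClosed.Build k (galg_sort C) (corner_pred P Q)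
    (corner_submod P Q).

Record corner (P Q : set G) :=
  Corner { corner_val :> C; corner_valP : corner_val \in corner_pred P Q }.

HB.instance Definition _ P Q := [isSub for @corner_val P Q].
HB.instance Definition _ P Q := [Choice of corner P Q by <:].
HB.instance Definition _ P Q := [SubChoice_isSubLmodule of corner P Q by <:].

Lemma corner_block P Q (c : corner P Q) : block P Q c.
Proof. exact/asboolP/(corner_valP c). Qed.

Lemma corner_val_linear P Q : linear (@corner_val P Q).
Proof. by []. Qed.

Lemma corner_val_inj P Q : injective (@corner_val P Q).
Proof. exact: val_inj. Qed.

Definition mk_corner P Q c (hc : block P Q c) : corner P Q :=
  Corner (asboolT hc).

Lemma corner_linear (V : lmodType k) P Q (f : V -> corner P Q) :
  linear (fun v => corner_val (f v)) -> linear f.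
Proof. by move=> f_lin a u v; apply: corner_val_inj; exact: f_lin. Qed.

Definition corner_grade P Q t : set (corner P Q) :=
  @corner_val P Q @^-1` grade C t.

Lemma corner_piece P Q t : @corner_val P Q @` corner_grade t = piece P Q t.
Proof.
apply/seteqP; split=> [_ [c hc <-]|c [cb hc]].
  by split=> //; exact: corner_block.
by exists (mk_corner cb).
Qed.

(** Homogeneous components in the skew group algebra are its coefficients, and
    taking a coefficient preserves the support in [P x Q]. *)
Lemma corner_direct P Q : direct_sum (@corner_grade P Q).
Proof.
apply: (direct_sum_preim (dU := grade_direct C) (@corner_val_linear P Q)
  (@corner_val_inj P Q)) => c t; rewrite dcomp_skew.
by exists (mk_corner (block_comp t (corner_block c))).
Qed.

Notation e := [set 1%g : G].

Lemma corner_emb_block b : block e e (corner_emb b).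
Proof. by rewrite -corner_emb_range; exists b. Qed.

Definition row_lact b (x : corner e setT) : corner e setT :=
  mk_corner (blockM (corner_emb_block b) (corner_block x)).

Definition row_ract (x : corner e setT) (c : C) : corner e setT :=
  mk_corner (blockM (corner_block x) (block_full c)).

Definition col_lact (c : C) (y : corner setT e) : corner setT e :=
  mk_corner (blockM (block_full c) (corner_block y)).

Definition col_ract (y : corner setT e) b : corner setT e :=
  mk_corner (blockM (corner_block y) (corner_emb_block b)).


Lemma corner_emb_mul_linearl (c : C) : linear (fun b => corner_emb b ** c).
Proof. by move=> a b b'; rewrite corner_emb_linear; exact: nmul_linearl. Qed.

Lemma corner_emb_mul_linearr (c : C) : linear (fun b => c ** corner_emb b).
Proof. by move=> a b b'; rewrite corner_emb_linear; exact: nmul_linearr. Qed.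

Lemma row_lact_linearl x : linear (row_lact^~ x).
Proof. by apply: corner_linear; exact: corner_emb_mul_linearl. Qed.

Lemma row_lact_linearr b : linear (row_lact b).
Proof. by apply: corner_linear => a x x'; exact: nmul_linearr. Qed.

Lemma row_ract_linearl c : linear (row_ract^~ c).
Proof. by apply: corner_linear => a x x'; exact: nmul_linearl. Qed.

Lemma row_ract_linearr x : linear (row_ract x).
Proof. by apply: corner_linear => a x' x''; exact: nmul_linearr. Qed.

Lemma row_lactA b b' x : row_lact (b ** b') x = row_lact b (row_lact b' x).
Proof. by apply: corner_val_inj; rewrite /= corner_embM nmulA. Qed.

Lemma row_ractA x c c' : row_ract x (c ** c') = row_ract (row_ract x c) c'.
Proof. by apply: corner_val_inj; exact: nmulA. Qed.

Lemma row_lractA b x c : row_ract (row_lact b x) c = row_lact b (row_ract x c).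
Proof. by apply: corner_val_inj; rewrite /= nmulA. Qed.

Definition row_bimod : bimod B C :=
  Bimod row_lact_linearl row_lact_linearr row_ract_linearl row_ract_linearr
    row_lactA row_ractA row_lractA.

Lemma col_lact_linearl y : linear (col_lact^~ y).
Proof. by apply: corner_linear => a c c'; exact: nmul_linearl. Qed.

Lemma col_lact_linearr c : linear (col_lact c).
Proof. by apply: corner_linear => a y y'; exact: nmul_linearr. Qed.

Lemma col_ract_linearl b : linear (col_ract^~ b).
Proof. by apply: corner_linear => a y y'; exact: nmul_linearl. Qed.

Lemma col_ract_linearr y : linear (col_ract y).
Proof. by apply: corner_linear; exact: corner_emb_mul_linearr. Qed.

Lemma col_lactA c c' y : col_lact (c ** c') y = col_lact c (col_lact c' y).
Proof. by apply: corner_val_inj; rewrite /= nmulA. Qed.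

Lemma col_ractA y b b' : col_ract y (b ** b') = col_ract (col_ract y b) b'.
Proof. by apply: corner_val_inj; rewrite /= corner_embM nmulA. Qed.

Lemma col_lractA c y b : col_ract (col_lact c y) b = col_lact c (col_ract y b).
Proof. by apply: corner_val_inj; rewrite /= nmulA. Qed.

Definition col_bimod : bimod C B :=
  Bimod col_lact_linearl col_lact_linearr col_ract_linearl col_ract_linearr
    col_lactA col_ractA col_lractA.

Lemma corner_emb_grade t b : grade B t b -> grade C t (corner_emb b).
Proof. by move=> /corner_emb_homog ->; exact: skew_unit_grade. Qed.

Lemma row_grade_lact s t b (x : row_bimod) :
  grade B s b -> corner_grade t x -> corner_grade (s * t)%g (lact b x).
Proof. by move=> /corner_emb_grade hb hx; exact: grade_mul hb hx. Qed.

Lemma row_grade_ract s t (x : row_bimod) c :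
  corner_grade s x -> grade C t c -> corner_grade (s * t)%g (ract x c).
Proof. by move=> hx hc; exact: (grade_mul (g := C) hx hc). Qed.

Lemma col_grade_lact s t c (y : col_bimod) :
  grade C s c -> corner_grade t y -> corner_grade (s * t)%g (lact c y).
Proof. by move=> hc hy; exact: (grade_mul (g := C) hc hy). Qed.

Lemma col_grade_ract s t (y : col_bimod) b :
  corner_grade s y -> grade B t b -> corner_grade (s * t)%g (ract y b).
Proof. by move=> hy /corner_emb_grade hb; exact: grade_mul hy hb. Qed.

Definition row_gbimod : gradedBimod B C :=
  GradedBimod (gbimod_sort := row_bimod) (corner_direct e setT)
    row_grade_lact row_grade_ract.

Definition col_gbimod : gradedBimod C B :=
  GradedBimod (gbimod_sort := col_bimod) (corner_direct setT e)
    col_grade_lact col_grade_ract.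

(** * The Morita context *)

(** A row times a column lies in the corner at the identity, which is a copy of
    [B]. *)
Lemma row_col_range (x : row_bimod) (y : col_bimod) :
  exists b, corner_emb b = corner_val x ** corner_val y.
Proof.
have := blockM (corner_block x) (corner_block y).
by rewrite -corner_emb_range => -[b _ bE]; exists b.
Qed.

Definition row_col x y : B := projT1 (cid (row_col_range x y)).

Lemma corner_emb_row_col x y :
  corner_emb (row_col x y) = corner_val x ** corner_val y.
Proof. exact: projT2 (cid (row_col_range x y)). Qed.

Lemma row_col_linearl y : linear (row_col^~ y).
Proof.
move=> a x x'; apply: corner_emb_inj.
by rewrite corner_emb_linear !corner_emb_row_col -nmul_linearl.
Qed.

Lemma row_col_linearr x : linear (row_col x).
Proof.
move=> a y y'; apply: corner_emb_inj.
by rewrite corner_emb_linear !corner_emb_row_col -nmul_linearr.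
Qed.

Lemma row_col_balanced x c y : row_col (ract x c) y = row_col x (lact c y).
Proof. by apply: corner_emb_inj; rewrite !corner_emb_row_col /= nmulA. Qed.

(** Columns and rows put no restriction on the support of their product, so this
    pairing takes values in the whole algebra and is the product itself. *)
Definition col_row (y : col_bimod) (x : row_bimod) : C :=
  corner_val y ** corner_val x.

Lemma col_row_linearl x : linear (col_row^~ x).
Proof. by move=> a y y'; exact: nmul_linearl. Qed.

Lemma col_row_linearr y : linear (col_row y).
Proof. by move=> a x x'; exact: nmul_linearr. Qed.

Lemma col_row_balanced y b x : col_row (ract y b) x = col_row y (lact b x).
Proof. by rewrite /col_row /= nmulA. Qed.

Lemma row_col_lact b x y : row_col (lact b x) y = b ** row_col x y.
Proof.
by apply: corner_emb_inj; rewrite corner_embM !corner_emb_row_col /= nmulA.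
Qed.

Lemma row_col_ract x y b : row_col x (ract y b) = row_col x y ** b.
Proof.
by apply: corner_emb_inj; rewrite corner_embM !corner_emb_row_col /= nmulA.
Qed.

Lemma col_row_lact c y x : col_row (lact c y) x = c ** col_row y x.
Proof. by rewrite /col_row /= nmulA. Qed.

Lemma col_row_ract y x c : col_row y (ract x c) = col_row y x ** c.
Proof. by rewrite /col_row /= nmulA. Qed.

Lemma row_col_liftE x y : tens_lift row_col (tens x y) = row_col x y.
Proof.
exact: tens_liftE row_col_linearl row_col_linearr row_col_balanced x y.
Qed.

Lemma col_row_liftE y x : tens_lift col_row (tens y x) = col_row y x.
Proof.
exact: tens_liftE col_row_linearl col_row_linearr col_row_balanced y x.
Qed.

Lemma row_col_row x y x' :
  lact (tens_lift row_col (tens x y)) x'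
    = ract x (tens_lift col_row (tens y x')).
Proof.
rewrite row_col_liftE col_row_liftE; apply: corner_val_inj.
by rewrite /= corner_emb_row_col nmulA.
Qed.

Lemma col_row_col y x y' :
  lact (tens_lift col_row (tens y x)) y'
    = ract y (tens_lift row_col (tens x y')).
Proof.
rewrite row_col_liftE col_row_liftE; apply: corner_val_inj.
by rewrite /= corner_emb_row_col nmulA.
Qed.

Definition corner_context : moritaContext row_gbimod col_gbimod :=
  MoritaContext (X := row_gbimod) (Y := col_gbimod)
    (tens_lift_hom (X := row_bimod) (Y := col_bimod) (V := regular_bimod B)
      row_col_linearl row_col_linearr row_col_balanced
      row_col_lact row_col_ract)
    (tens_lift_hom (X := col_bimod) (Y := row_bimod) (V := regular_bimod C)
      col_row_linearl col_row_linearr col_row_balanced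
      col_row_lact col_row_ract)
    row_col_row col_row_col.

Lemma tauA_corner x y : tauA corner_context (tens x y) = row_col x y.
Proof. exact: row_col_liftE. Qed.

Lemma tauB_corner y x : tauB corner_context (tens y x) = col_row y x.
Proof. exact: col_row_liftE. Qed.

Lemma corner_emb_gradeE t b : grade C t (corner_emb b) -> grade B t b.
Proof.
move=> hb; have : piece e e t (corner_emb b).
  by split=> //; exact: corner_emb_block.
by rewrite -corner_emb_piece => -[c hc /corner_emb_inj <-].
Qed.

Lemma corner_context_graded : graded_context corner_context.
Proof.
split=> r s x y hx hy.
  rewrite tauA_corner; apply: corner_emb_gradeE; rewrite corner_emb_row_col.
  exact: grade_mul hx hy.
by rewrite tauB_corner; exact: grade_mul hx hy.
Qed.

(** * Consequences of strong gradedness *)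

Hypothesis sB : strongly_graded B.

(** The middle index can be taken to be [1], here and in the lemmas that follow,
    because [1] belongs to both [setT] and [[set 1]]. *)
Lemma skew_strongly_graded : strongly_graded C.
Proof.
move=> s t; rewrite -!pieceTT.
exact: (span2_piece _ _ _ _ sB (v := 1%g)).
Qed.

Lemma span2_row_col s t :
  span2 row_col (corner_grade s) (corner_grade t) = grade B (s * t)%g.
Proof.
apply: (span2_transport corner_emb_linear corner_emb_inj corner_emb_row_col).
rewrite (corner_piece e setT s) (corner_piece setT e t) corner_emb_piece.
exact: (span2_piece _ _ _ _ sB (v := 1%g)).
Qed.

Lemma span2_col_row s t :
  span2 col_row (corner_grade s) (corner_grade t) = grade C (s * t)%g.
Proof.
apply: (span2_transport (j := @idfun C)) => //.
rewrite (corner_piece setT e s) (corner_piece e setT t) image_id -pieceTT.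
exact: (span2_piece _ _ _ _ sB (v := 1%g)).
Qed.

Lemma span2_row_lact s t :
  span2 row_lact (grade B s) (corner_grade t) = corner_grade (s * t)%g.
Proof.
apply: (span2_transport (g := corner_emb) (h := @corner_val e setT)
  (@corner_val_linear e setT) (@corner_val_inj e setT)) => //.
rewrite !corner_piece corner_emb_piece.
exact: (span2_piece _ _ _ _ sB (v := 1%g)).
Qed.

Lemma span2_row_ract s t :
  span2 row_ract (corner_grade s) (grade C t) = corner_grade (s * t)%g.
Proof.
apply: (span2_transport (g := @corner_val e setT) (h := idfun)
  (@corner_val_linear e setT) (@corner_val_inj e setT)) => //.
rewrite !corner_piece image_id -pieceTT.
exact: (span2_piece _ _ _ _ sB (v := 1%g)).
Qed.

Lemma span2_col_lact s t :
  span2 col_lact (grade C s) (corner_grade t) = corner_grade (s * t)%g.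
Proof.
apply: (span2_transport (g := idfun) (h := @corner_val setT e)
  (@corner_val_linear setT e) (@corner_val_inj setT e)) => //.
rewrite !corner_piece image_id -pieceTT.
exact: (span2_piece _ _ _ _ sB (v := 1%g)).
Qed.

Lemma span2_col_ract s t :
  span2 col_ract (corner_grade s) (grade B t) = corner_grade (s * t)%g.
Proof.
apply: (span2_transport (g := @corner_val setT e) (h := corner_emb)
  (@corner_val_linear setT e) (@corner_val_inj setT e)) => //.
rewrite !corner_piece corner_emb_piece.
exact: (span2_piece _ _ _ _ sB (v := 1%g)).
Qed.

End Corner.

(** * Strongly graded algebras *)

Section StronglyGraded.
Variables (k : comPzRingType) (G : groupType) (A : gradedAlg k G).
Hypothesis sA : strongly_graded A.

Lemma strongly_graded_ideal t : grade_ideal A t = grade A 1%g.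
Proof. by rewrite /grade_ideal sA mulgV. Qed.

Lemma strongly_graded_ideals_idempotent : grade_ideals_idempotent A.
Proof. by move=> t; rewrite !strongly_graded_ideal sA mulg1. Qed.

Lemma strongly_graded_idempotent : idempotent_alg A.
Proof.
apply/seteqP; split=> // a _; move: a.
apply: (direct_sum_ind (grade_direct A) (span_submodule _)) => t a.
rewrite -[t]mul1g -sA; apply: span2_sub; first exact: span_submodule.
by move=> b c _ _; exact: span2_gen.
Qed.

End StronglyGraded.

(** A linear map is onto a graded algebra once its values on the [p x y] fill
    each degree; one fixed set [U] on the left is enough. *)
Lemma graded_range (k : comPzRingType) (G : groupType) (A : gradedAlg k G)
    (X Y : Type) (M : lmodType k) (p : X -> Y -> M) (f : M -> A)
    (U : set X) (V : G -> set Y) :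
  linear f -> (forall t, span2 (fun x y => f (p x y)) U (V t) = grade A t) ->
  forall a, exists m, f m = a.
Proof.
move=> f_lin fE a; suff : range f a by case=> m _; exists m.
move: a; apply: (direct_sum_ind (grade_direct A)).
  by apply: submodule_image f_lin _.
move=> t; rewrite -fE; apply: span2_sub.
  by apply: submodule_image f_lin _.
by move=> x y _ _; exists (p x y).
Qed.

Theorem corollary7p11 (k : comPzRingType) (G : groupType) (B : gradedAlg k G) :
  strongly_graded B ->
  strongly_graded_equivalent B (skew_group_alg (smash_action B)).
Proof.
move=> sB; have sC := skew_strongly_graded sB.
split; try exact: strongly_graded_idempotent;
  try exact: strongly_graded_ideals_idempotent.
have EA : (fun x y => tauA (corner_context B) (tens x y)) = @row_col k G B.
  by apply/funext => x; apply/funext => y; exact: tauA_corner.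
have EB : (fun y x => tauB (corner_context B) (tens y x)) = @col_row k G B.
  by apply/funext => y; apply/funext => x; exact: tauB_corner.
exists (row_gbimod B), (col_gbimod B), (corner_context B); split.
- exact: corner_context_graded.
- move=> t; rewrite !strongly_graded_ideal //; split.
    by rewrite (span2_row_lact sB) mul1g.
  by rewrite (span2_row_ract sB) mulg1.
- move=> t; rewrite !strongly_graded_ideal //; split.
    by rewrite (span2_col_lact sB) mul1g.
  by rewrite (span2_col_ract sB) mulg1.
- split.
    have [lin _ _] := tauA_hom (corner_context B).
    apply: (graded_range (p := fun x y => tens x y)
      (U := bgrade (row_gbimod B) 1%g) (V := bgrade (col_gbimod B)) lin) => t.
    by rewrite EA span2_row_col // mul1g.
  have [lin _ _] := tauB_hom (corner_context B).
  apply: (graded_range (p := fun y x => tens y x)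
    (U := bgrade (col_gbimod B) 1%g) (V := bgrade (row_gbimod B)) lin) => t.
  by rewrite EB span2_col_row // mul1g.
- move=> t; rewrite EA EB !strongly_graded_ideal //.
  by rewrite span2_row_col // span2_col_row // mulgV.
Qed.
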